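(* Let $X$ be a Dedekind complete Banach lattice, and let $A,B\in\mathcal{L}(X)$ be nonzero operators. The multiplication operator $L_AR_B\colon\mathcal{L}_r(X)\to\mathcal{L}_r(X)$ is a band projection if and only if there exists $\lambda\in\mathbb{R}\setminus\{0\}$ such that $\lambda A$ and $B/\lambda$ are band projections.
   Context: Banach lattices are real. $\mathcal{L}(X)$ is the space of bounded linear operators on $X$, ordered by $S\le T$ iff $Sx\le Tx$ for all $x\in X_+$; $\mathcal{L}_r(X)$ is the linear span of the positive operators (for $X$ Dedekind complete it is a Banach lattice with the regular norm). The multiplication operator is $L_AR_B(T)=ATB$; ''$L_AR_B\colon\mathcal{L}_r(X)\to\mathcal{L}_r(X)$ is a band projection'' means that $T\mapsto ATB$ maps $\mathcal{L}_r(X)$ into itself and is a band projection there. A band projection on a Banach lattice $Y$ is a linear map $P\colon Y\to Y$ with $P^2=P$ and $0\le P\le I_Y$. *)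

(* Defs.v *)
From HB Require Import structures.
From mathcomp Require Import all_boot all_order all_algebra.
From mathcomp Require Import all_classical all_reals all_analysis.

Set Implicit Arguments.
Unset Strict Implicit.
Unset Printing Implicit Defensive.

Import Order.TTheory GRing.Theory Num.Theory.
Import numFieldNormedType.Exports.

Local Open Scope classical_set_scope.
Local Open Scope ring_scope.

HB.mixin Record isOrderedLmodule (R : numDomainType) V
    & Num.POrderedZmodule V & GRing.Lmodule R V := {
  lev_wD2r : forall z x y : V, x <= y -> x + z <= y + z ;
  scalev_wge0 : forall (a : R) (x : V), 0 <= a -> 0 <= x -> 0 <= a *: x
}.

#[short(type="orderedLmodType")]
HB.structure Definition OrderedLmodule (R : numDomainType) :=
  {V of isOrderedLmodule R V & Num.POrderedZmodule V & GRing.Lmodule R V}.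

(* A plain record rather than an HB structure: HB cannot add a join of
   [Order.Preorder ring_display] and [Num.SemiNormedZmodule] below the already
   declared [Num.NumDomain]. The order and the norm are both attached to the
   carrier [blattice_sort] below. *)
Record banachLatticeType (R : realType) := BanachLatticeType {
  bl_space : completeNormedModType R ;
  bl_le : rel bl_space ;
  bl_join : bl_space -> bl_space -> bl_space ;
  bl_meet : bl_space -> bl_space -> bl_space ;
  bl_le_refl : reflexive bl_le ;
  bl_le_anti : antisymmetric bl_le ;
  bl_le_trans : transitive bl_le ;
  bl_leUx : forall x y z, bl_le (bl_join x y) z = bl_le x z && bl_le y z ;
  bl_lexI : forall x y z, bl_le x (bl_meet y z) = bl_le x y && bl_le x z ;
  bl_leD2r : forall z x y, bl_le x y -> bl_le (x + z) (y + z) ;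
  bl_scale_ge0 : forall (a : R) x, 0 <= a -> bl_le 0 x -> bl_le 0 (a *: x) ;
  (* [bl_join x (- x)] is the lattice modulus of x *)
  bl_norm : forall x y,
    bl_le (bl_join x (- x)) (bl_join y (- y)) -> `|x| <= `|y|
}.

Definition blattice_sort (R : realType) (X : banachLatticeType R) : Type :=
  bl_space X.
Coercion blattice_sort : banachLatticeType >-> Sortclass.

Section BanachLatticeInstances.
Context {R : realType} (X : banachLatticeType R).

HB.instance Definition _ := CompleteNormedModule.copy X (bl_space X).

HB.instance Definition _ := Order.Le_isPOrder.Build ring_display X
  (@bl_le_refl R X) (@bl_le_anti R X) (@bl_le_trans R X).

HB.instance Definition _ := Order.POrder_MeetJoin_isLattice.Build ring_display X
  (@bl_lexI R X) (@bl_leUx R X).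

HB.instance Definition _ :=
  isOrderedLmodule.Build R X (@bl_leD2r R X) (@bl_scale_ge0 R X).

End BanachLatticeInstances.

Definition dedekind_complete (d : Order.disp_t) (T : porderType d) : Prop :=
  forall S : set T, has_sup S -> exists m, isLub S m.

Definition band_projection (R : numDomainType) (Y : orderedLmodType R)
    (P : {linear Y -> Y}) : Prop :=
  (forall y, P (P y) = P y) /\ (forall y, 0 <= y -> 0 <= P y /\ P y <= y).

Section BoundedOperators.
Context {R : realType} {X : banachLatticeType R}.

Definition bounded_linear : {pred X -> X} := fun T =>
  `[< linear T /\ exists M : R, forall x, `|T x| <= M * `|x| >].

Lemma bounded_linearP (T : X -> X) : reflect
  (linear T /\ exists M : R, forall x, `|T x| <= M * `|x|)
  (T \in bounded_linear).
Proof. exact: asboolP. Qed.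

Lemma bounded_linear_submod : submod_closed bounded_linear.
Proof.
split=> [|a S T /bounded_linearP[linS [M MS]] /bounded_linearP[linT [N NT]]].
  apply/bounded_linearP; split=> [b x y|].
    by rewrite -[LHS]/(0 : X) -[RHS]/(b *: (0 : X) + 0) scaler0 addr0.
  by exists 0 => x; rewrite -[X in `|X|]/(0 : X) normr0 mul0r.
apply/bounded_linearP; split=> [b x y|].
  rewrite -[LHS]/(a *: S (b *: x + y) + T (b *: x + y)).
  rewrite -[RHS]/(b *: (a *: S x + T x) + (a *: S y + T y)).
  rewrite linS linT !scalerDr !scalerA (mulrC a b).
  by rewrite -!addrA; congr (_ + _); rewrite addrCA.
exists (`|a| * M + N) => x; rewrite -[X in `|X| <= _]/(a *: S x + T x).
rewrite (le_trans (ler_normD _ _))// mulrDl lerD//.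
by rewrite normrZ -mulrA ler_wpM2l.
Qed.

HB.instance Definition _ :=
  GRing.isSubmodClosed.Build R (X -> X) bounded_linear bounded_linear_submod.

End BoundedOperators.

Section BoundedOp.
Context {R : realType}.

Record boundedOp (X : banachLatticeType R) := BoundedOp {
  bop_fun :> X -> X ;
  _ : bop_fun \in bounded_linear }.

End BoundedOp.

Notation "''L' ( X )" := (boundedOp X) (format "''L' ( X )") : type_scope.

Section BoundedOpTheory.
Context {R : realType} {X : banachLatticeType R}.

HB.instance Definition _ := [isSub for @bop_fun R X].
HB.instance Definition _ := [Choice of 'L(X) by <:].
HB.instance Definition _ := [SubChoice_isSubLmodule of 'L(X) by <:].

Lemma bop_linear (T : 'L(X)) : linear T.
Proof. by have /bounded_linearP[] := valP T. Qed.

HB.instance Definition _ (T : 'L(X)) :=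
  GRing.isLinear.Build R X X _ (bop_fun T) (bop_linear T).

Definition bop_le (S T : 'L(X)) : bool := `[< forall x, 0 <= x -> S x <= T x >].

Lemma bop_le_refl : reflexive bop_le.
Proof. by move=> S; apply/asboolP. Qed.

Lemma bop_le_anti : antisymmetric bop_le.
Proof.
move=> S T /andP[/asboolP ST /asboolP TS].
have ST0 x : 0 <= x -> S x = T x.
  by move=> x0; apply/le_anti; rewrite ST// TS.
apply/val_inj/funext => x /=; set z : X := Order.join x 0.
have zx0 : 0 <= z - x by rewrite -[leLHS](subrr x) lev_wD2r// leUl.
have UB (U : 'L(X)) : U x = U z - U (z - x).
  by rewrite -[RHS](linearB U) opprB addrCA subrr addr0.
by rewrite UB [RHS]UB (ST0 z) ?leUr// (ST0 _ zx0).
Qed.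

Lemma bop_le_trans : transitive bop_le.
Proof.
move=> T S U /asboolP ST /asboolP TU; apply/asboolP => x x0.
exact: le_trans (ST _ x0) (TU _ x0).
Qed.

HB.instance Definition _ := Order.Le_isPOrder.Build ring_display 'L(X)
  bop_le_refl bop_le_anti bop_le_trans.

Lemma bop_leP (S T : 'L(X)) : reflect (forall x, 0 <= x -> S x <= T x) (S <= T).
Proof. exact: asboolP. Qed.

Fact bop_wD2r (U S T : 'L(X)) : S <= T -> S + U <= T + U.
Proof. by move=> /bop_leP ST; apply/bop_leP => x x0; rewrite lev_wD2r// ST. Qed.

Fact bop_scale_wge0 (a : R) (T : 'L(X)) : 0 <= a -> 0 <= T -> 0 <= a *: T.
Proof.
move=> a0 /bop_leP T0; apply/bop_leP => x x0.
by rewrite scalev_wge0//; apply: T0.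
Qed.

HB.instance Definition _ :=
  isOrderedLmodule.Build R 'L(X) bop_wD2r bop_scale_wge0.

Lemma bop_comp_subproof (S T : 'L(X)) : (S \o T) \in bounded_linear.
Proof.
have /bounded_linearP[_ [M MS]] := valP S.
have /bounded_linearP[_ [N NT]] := valP T.
apply/bounded_linearP; split=> [a x y|]; first by rewrite /= !linearP.
exists (`|M| * N) => x /=; apply: (le_trans (MS _)).
apply: (@le_trans _ _ (`|M| * `|T x|)); first by rewrite ler_wpM2r// ler_norm.
by rewrite -mulrA ler_wpM2l//; exact: NT.
Qed.

Definition bop_comp (S T : 'L(X)) : 'L(X) := BoundedOp (bop_comp_subproof S T).

(* the multiplication operator L_A R_B *)
Definition mulop (A B T : 'L(X)) : 'L(X) := bop_comp A (bop_comp T B).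

Definition regular : {pred 'L(X)} := fun T => `[< exists (n : nat)
  (c : 'I_n -> R) (P : 'I_n -> 'L(X)),
  (forall i, 0 <= P i) /\ T = \sum_i c i *: P i >].

Lemma regularP (T : 'L(X)) : reflect (exists (n : nat)
    (c : 'I_n -> R) (P : 'I_n -> 'L(X)),
    (forall i, 0 <= P i) /\ T = \sum_i c i *: P i)
  (T \in regular).
Proof. exact: asboolP. Qed.

Lemma regular_submod : submod_closed regular.
Proof.
split=> [|a S T /regularP[m [c [P [P0 ->]]]] /regularP[n [d [Q [Q0 ->]]]]].
  by apply/regularP; exists 0%N, (fun=> 0), (fun=> 0); rewrite big_ord0; split.
apply/regularP; exists (m + n)%N,
  (fun i : 'I_(m + n) => match fintype.split i with inl j => a * c j | inr j => d j end),
  (fun i : 'I_(m + n) => match fintype.split i with inl j => P j | inr j => Q j end).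
split=> [i|]; first by case: fintype.split.
rewrite big_split_ord/= scaler_sumr; congr (_ + _); apply: eq_bigr => i _.
  by rewrite (unsplitK (inl _ i)) scalerA.
by rewrite (unsplitK (inr _ i)).
Qed.

HB.instance Definition _ :=
  GRing.isSubmodClosed.Build R 'L(X) regular regular_submod.

End BoundedOpTheory.

Section RegularOp.
Context {R : realType}.

Record regularOp (X : banachLatticeType R) := RegularOp {
  rop_val :> 'L(X) ;
  _ : rop_val \in regular }.

End RegularOp.

Notation "''Lr' ( X )" := (regularOp X) (format "''Lr' ( X )") : type_scope.

Section RegularOpTheory.
Context {R : realType} {X : banachLatticeType R}.

HB.instance Definition _ := [isSub for @rop_val R X].
HB.instance Definition _ := [Choice of 'Lr(X) by <:].
HB.instance Definition _ := [SubChoice_isSubLmodule of 'Lr(X) by <:].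
HB.instance Definition _ :=
  [SubChoice_isSubPOrder of 'Lr(X) by <: with ring_display].

Lemma rop_leE (S T : 'Lr(X)) : (S <= T) = (rop_val S <= rop_val T).
Proof. by []. Qed.

Fact rop_wD2r (U S T : 'Lr(X)) : S <= T -> S + U <= T + U.
Proof. by rewrite !rop_leE; exact: lev_wD2r. Qed.

Fact rop_scale_wge0 (a : R) (T : 'Lr(X)) : 0 <= a -> 0 <= T -> 0 <= a *: T.
Proof. by rewrite !rop_leE; exact: scalev_wge0. Qed.

HB.instance Definition _ :=
  isOrderedLmodule.Build R 'Lr(X) rop_wD2r rop_scale_wge0.

End RegularOpTheory.

(* L_A R_B maps L_r(X) into itself, and the map it induces there is a band
   projection. *)
Definition mulop_band_projection (R : realType) (X : banachLatticeType R)
    (A B : 'L(X)) : Prop :=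
  exists Phi : {linear 'Lr(X) -> 'Lr(X)},
    (forall T : 'Lr(X), rop_val (Phi T) = mulop A B T) /\ band_projection Phi.

(* Main.v *)
(* Positive functionals separate the order of X: apply Hahn-Banach to the
   sublinear functional x |-> |x^+|. Testing L_A R_B on the rank-one operators
   T = f (.) y with f, y >= 0, for which A T B x = f(B x) A y, gives
     0 <= f(B x) A y <= f(x) y   and   f(B^2 x) A^2 y = f(B x) A y.
   The lower bound makes A and B positive after rescaling by some f(B x). With
   b = sup f(B x) / f(x), the upper bound yields b A <= I and B <= b I. For
   A' = b A and B' = B / b we then have f(B'^2 x) <= f(B' x) and
   g(A'^2 y) <= g(A' y), while the products of the two sides agree; hence
   A'^2 = A' and B'^2 = B'. *)
Require Import Defs.
From HB Require Import structures.
From mathcomp Require Import all_boot all_order all_algebra.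
From mathcomp Require Import all_classical all_reals all_analysis.
From mathcomp Require Import lra.

Import Order.TTheory GRing.Theory Num.Theory.
Import numFieldNormedType.Exports.
Local Open Scope ring_scope.

(** * The Hahn-Banach theorem *)

Section HahnBanach.
Context {R : realType} {V : lmodType R}.
Implicit Types (t : R) (p q : V -> R) (G : set (V -> R)).

Definition sublinear p :=
  (forall x y, p (x + y) <= p x + p y) /\
  (forall t x, 0 <= t -> p (t *: x) <= t * p x).

Lemma sublinear0 p : sublinear p -> p 0 = 0.
Proof.
move=> [pD pZ]; have := pD 0 0; have := pZ 0 0 (lexx _).
by rewrite addr0 scale0r mul0r; move=> *; lra.
Qed.

Lemma sublinearZ p t x : sublinear p -> 0 <= t -> p (t *: x) = t * p x.
Proof.
move=> sp; rewrite le_eqVlt => /predU1P[<-|t0].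
  by rewrite scale0r mul0r sublinear0.
apply/le_anti; rewrite sp.2/=; last exact: ltW.
have ti0 : 0 <= t^-1 by rewrite invr_ge0 ltW.
have := sp.2 _ (t *: x) ti0.
by rewrite scalerA mulVf ?gt_eqF// scale1r mulrC ler_pdivlMr// mulrC.
Qed.

Lemma sublinearN p x : sublinear p -> - p (- x) <= p x.
Proof. by move=> sp; have := sp.1 x (- x); rewrite subrr sublinear0//; move=> *; lra. Qed.

(** [inf] is a true infimum only for a nonempty set with a lower bound; hence the member of [G] and
    the bound [l] in the lemmas below. *)
Definition infG G (x : V) : R := inf [set g x | g in G]%classic.

Lemma infG_le G l g x : (forall h, G h -> l <= h x) -> G g -> infG G x <= g x.
Proof.
by move=> lG Gg; apply: ge_inf; [exists l => _ [h Gh <-]; exact: lG|exists g].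
Qed.

Lemma le_infG G g l x : G g -> (forall h, G h -> l <= h x) -> l <= infG G x.
Proof.
move=> Gg lG; apply: lb_le_inf; first by exists (g x), g.
by move=> _ [h Gh <-]; exact: lG.
Qed.

(** The member [k] may depend on the points, so that both the translates in [tilt] and a chain of
    sublinear functionals qualify. *)
Lemma sublinear_infG G g0 : G g0 ->
    (forall x, exists l, forall g, G g -> l <= g x) ->
    (forall g h x y, G g -> G h -> exists2 k, G k & k (x + y) <= g x + h y) ->
    (forall g t x, G g -> 0 <= t -> exists2 k, G k & k (t *: x) <= t * g x) ->
  sublinear (infG G).
Proof.
move=> Gg0 lbG GD GZ.
have infle g x : G g -> infG G x <= g x.
  by have [l lG] := lbG x; exact: infG_le lG.
split=> [x y|t x].
  rewrite -lerBlDr; apply: (le_infG _ g0) => // g Gg.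
  rewrite lerBlDr -lerBlDl; apply: (le_infG _ g0) => // h Gh.
  rewrite lerBlDl; have [k Gk] := GD g h x y Gg Gh.
  exact/le_trans/infle.
rewrite le_eqVlt => /predU1P[<-|t0].
  have [k Gk] := GZ _ 0 x Gg0 (lexx 0); rewrite !mul0r.
  exact/le_trans/infle.
rewrite mulrC -ler_pdivrMr//; apply: (le_infG _ g0) => // g Gg.
rewrite ler_pdivrMr// mulrC; have [k Gk] := GZ _ _ x Gg (ltW t0).
exact/le_trans/infle.
Qed.

(* The largest sublinear q <= p such that q (x + t *: a) = q x + t * p a for
   t >= 0. Minimality of p forces tilt p a = p, which is additivity of p. *)
Definition tilt p (a : V) : V -> R :=
  infG [set g | exists2 t, 0 <= t & g = fun x => p (x + t *: a) - t * p a]%classic.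

(** Subadditivity on [t *: a = - x + (x + t *: a)]. The bound is independent of [t], so the infimum
    in [tilt] is finite. *)
Lemma tilt_lb p a t x : sublinear p -> 0 <= t ->
  - p (- x) <= p (x + t *: a) - t * p a.
Proof.
move=> sp t0; rewrite -(sublinearZ p)//.
by have := sp.1 (- x) (x + t *: a); rewrite addKr; move=> *; lra.
Qed.

Lemma tilt_le p a t x : sublinear p -> 0 <= t ->
  tilt p a x <= p (x + t *: a) - t * p a.
Proof.
move=> sp t0; apply: (infG_le _ (- p (- x))
  (fun x => p (x + t *: a) - t * p a)); last by exists t.
by move=> _ [s s0 ->]; exact: tilt_lb.
Qed.

(** Under addition the parameters [s] and [t] combine to [s + t]; scaling by [t] turns [s] into
    [t * s]. *)
Lemma sublinear_tilt p a : sublinear p -> sublinear (tilt p a).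
Proof.
move=> sp; apply: (sublinear_infG _ (fun x => p (x + 0 *: a) - 0 * p a)).
- by exists 0.
- by move=> x; exists (- p (- x)) => _ [t t0 ->]; exact: tilt_lb.
- move=> _ _ x y [s s0 ->] [t t0 ->]; exists (fun x => p (x + (s + t) *: a) - (s + t) * p a).
    by exists (s + t) => //; exact: addr_ge0.
  have := sp.1 (x + s *: a) (y + t *: a).
  by rewrite addrACA -scalerDl; move=> *; lra.
- move=> _ t x [s s0 ->] t0; exists (fun x => p (x + (t * s) *: a) - (t * s) * p a).
    by exists (t * s) => //; exact: mulr_ge0.
  by rewrite -scalerA -scalerDr sublinearZ// mulrBr mulrA.
Qed.

Lemma minimal_sublinear_scalar q : sublinear q ->
  (forall q', sublinear q' -> (forall x, q' x <= q x) -> q' = q) -> scalar q.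
Proof.
move=> sq qmin.
have tiltq a : tilt q a = q.
  apply: qmin => [|x]; first exact: sublinear_tilt.
  by have := tilt_le q a 0 x sq (lexx 0); rewrite scale0r addr0 mul0r subr0.
have qD x a : q (x + a) = q x + q a.
  apply/le_anti; rewrite sq.1/=.
  by have := tilt_le q a 1 x sq ler01; rewrite tiltq scale1r mul1r; move=> *; lra.
have qN x : q (- x) = - q x.
  by have := qD x (- x); rewrite subrr sublinear0//; move=> *; lra.
move=> t x y; rewrite qD; congr (_ + _).
(* Oddness extends homogeneity to negative scalars. *)
have [t0|t0] := leP 0 t; first exact: sublinearZ.
rewrite -[t]opprK scaleNr qN sublinearZ ?oppr_ge0 ?ltW//=.
by rewrite !mulNr.
Qed.

Lemma exists_minimal_sublinear p : sublinear p -> exists2 q, sublinear q &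
  (forall x, q x <= p x) /\
  (forall q', sublinear q' -> (forall x, q' x <= q x) -> q' = q).
Proof.
move=> sp.
pose T := {q : V -> R | sublinear q /\ forall x, q x <= p x}.
(* The pointwise order is reversed, so that the maximal element given by [Zorn] is a minimal
   functional. *)
pose ge (q r : T) := `[< forall x, sval r x <= sval q x >].
have [|r s t /asboolP rs /asboolP st| | |q qmax] := @Zorn T ge.
- by move=> q; apply/asboolP.
- by apply/asboolP => x; exact: le_trans (st x) (rs x).
- move=> [r rP] [s sP] /asboolP rs /asboolP sr; apply/eq_exist/funext => x.
  by apply/le_anti; rewrite rs sr.
(* The empty chain is bounded by [p], a nonempty one by its pointwise infimum. *)
- move=> C Ctot; have [[c0 Cc0]|C0] := pselect (exists c, C c); last first.
    have pP : sublinear p /\ forall x, p x <= p x by [].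
    by exists (exist _ p pP) => s Cs; case: C0; exists s.
  pose G := [set sval c | c in C]%classic.
  have lbG x g : G g -> - p (- x) <= g x.
    move=> [[c [sc cp]] _ <-] /=; apply: le_trans (sublinearN _ _ sc).
    by rewrite lerN2.
  have sG : sublinear (infG G).
    apply: (sublinear_infG _ (sval c0)).
    + by exists c0.
    + by move=> x; exists (- p (- x)) => g; exact: lbG.
    + move=> _ _ x y [c Cc <-] [d Cd <-].
      (* The smaller of the two functionals serves as [k]. *)
      have [/asboolP cd|/asboolP dc] := Ctot _ _ Cc Cd.
        exists (sval d); first by exists d.
        by rewrite (le_trans ((svalP d).1.1 x y))// lerD2r.
      exists (sval c); first by exists c.
      by rewrite (le_trans ((svalP c).1.1 x y))// lerD2l.
    + move=> _ t x [c Cc <-] t0; exists (sval c); first by exists c.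
      exact: (svalP c).1.2.
  have Gle c x : C c -> infG G x <= sval c x.
    by move=> Cc; apply: (infG_le _ _ _ _ (lbG x)); exists c.
  have GP : sublinear (infG G) /\ forall x, infG G x <= p x.
    by split=> // x; apply: le_trans (Gle _ x Cc0) ((svalP c0).2 x).
  by exists (exist _ (infG G) GP) => c Cc; apply/asboolP => x; exact: Gle.
exists (sval q); first exact: (svalP q).1.
split=> [|q' sq' q'q]; first exact: (svalP q).2.
have q'P : sublinear q' /\ forall x, q' x <= p x.
  by split=> // x; exact: le_trans (q'q x) ((svalP q).2 x).
have := qmax (exist _ q' q'P).
by move=> /(_ (introT (asboolP _) q'q)) <-.
Qed.

(** A minimal functional is taken below [tilt p a], whose value at [- a] is at most [- p a]; this
    forces [p a <= f a]. *)
Lemma hahn_banach p a : sublinear p ->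
  exists2 f : {scalar V}, (forall x, f x <= p x) & f a = p a.
Proof.
move=> sp; have [q sq [qp qmin]] := exists_minimal_sublinear _ (sublinear_tilt p a sp).
pose L := GRing.isLinear.Build R V R *%R q (minimal_sublinear_scalar q sq qmin).
pose f : {scalar V} := HB.pack q L.
have fp x : f x <= p x.
  apply: le_trans (qp x) _.
  by have := tilt_le p a 0 x sp (lexx 0); rewrite scale0r addr0 mul0r subr0.
exists f => //; apply/le_anti; rewrite fp/=.
have := le_trans (qp (- a)) (tilt_le p a 1 (- a) sp ler01).
rewrite scale1r addNr sublinear0// mul1r sub0r -[q (- a)]/(f (- a)) linearN.
by rewrite lerN2.
Qed.

End HahnBanach.

(** * Positive functionals on a Banach lattice *)

Section OrderedModule.
Context {R : numFieldType} {V : orderedLmodType R}.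
Implicit Types (x y z : V) (a : R).

Lemma subv_ge0 x y : (0 <= y - x) = (x <= y).
Proof.
by apply/idP/idP => /lev_wD2r; [move=> /(_ x)|move=> /(_ (- x))];
  rewrite ?subrK ?add0r ?subrr.
Qed.

Lemma lev_wD x y x' y' : x <= y -> x' <= y' -> x + x' <= y + y'.
Proof.
move=> xy xy'; apply: le_trans (lev_wD2r x' _ _ xy) _.
by rewrite ![y + _]addrC lev_wD2r.
Qed.

Lemma scalev_wle a x y : 0 <= a -> x <= y -> a *: x <= a *: y.
Proof. by move=> a0 xy; rewrite -subv_ge0 -scalerBr scalev_wge0// subv_ge0. Qed.

Lemma scalev_le a x y : 0 < a -> (a *: x <= a *: y) = (x <= y).
Proof.
move=> a0; apply/idP/idP => [|]; last exact/scalev_wle/ltW.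
have a0' : 0 <= a^-1 by rewrite invr_ge0 ltW.
by move=> /(scalev_wle _ _ _ a0'); rewrite !scalerA mulVf ?gt_eqF// !scale1r.
Qed.

Lemma oppv_ge0 x : (0 <= - x) = (x <= 0).
Proof. by rewrite -[- x]add0r subv_ge0. Qed.

End OrderedModule.

Section BanachLattice.
Context {R : realType} {X : banachLatticeType R}.
Implicit Types (x y : X) (f : {scalar X}).

Definition pospart x : X := Order.join x 0.

Lemma pospart_ge0 x : 0 <= pospart x. Proof. exact: leUr. Qed.

Lemma le_pospart x : x <= pospart x. Proof. exact: leUl. Qed.

Lemma pospart_le x y : 0 <= y -> x <= y -> pospart x <= y.
Proof. by move=> y0 xy; rewrite leUx xy. Qed.

Lemma pospart_eq0 x : (pospart x == 0) = (x <= 0).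
Proof.
apply/idP/idP => [/eqP <-|x0]; first exact: le_pospart.
by apply/eqP/le_anti; rewrite pospart_ge0 pospart_le.
Qed.

Lemma pos_decomp x : exists u v : X, [/\ 0 <= u, 0 <= v & x = u - v].
Proof.
exists (pospart x), (pospart x - x); split; first exact: pospart_ge0.
  by rewrite subv_ge0 le_pospart.
by rewrite subKr.
Qed.

Lemma modulus_ge0 x : 0 <= Order.join x (- x).
Proof.
(* Twice the modulus dominates [x + (- x) = 0]. *)
rewrite -(scalev_le (2%:R : R))// scaler0 scaler_nat -[leLHS](subrr x).
by apply: lev_wD; [exact: leUl|exact: leUr].
Qed.

Lemma norm_le_modulus x y :
  Order.join x (- x) <= Order.join y (- y) -> `|x| <= `|y|.
Proof. exact: bl_norm. Qed.

Lemma norm_monotone x y : 0 <= x -> x <= y -> `|x| <= `|y|.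
Proof.
move=> x0 xy; apply: norm_le_modulus; apply: (@le_trans _ _ y); last exact: leUl.
rewrite leUx xy/=; apply: le_trans (le_trans x0 xy).
by rewrite -oppv_ge0 opprK.
Qed.

Lemma norm_pospart x : `|pospart x| <= `|x|.
Proof.
apply: norm_le_modulus; have px0 := pospart_ge0 x; rewrite leUx.
apply/andP; split; last first.
  by apply: le_trans (modulus_ge0 x); rewrite -oppv_ge0 opprK.
by apply: pospart_le; [exact: modulus_ge0|exact: leUl].
Qed.

(** The positive part is the least positive upper bound, so it is itself sublinear, and the norm is
    monotone on the positive cone. *)
Lemma sublinear_norm_pospart : sublinear (fun x : X => `|pospart x|).
Proof.
split=> [x y|t x t0].
  apply: le_trans (ler_normD _ _); apply: norm_monotone; first exact: pospart_ge0.
  apply: pospart_le; last by apply: lev_wD; exact: le_pospart.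
  by rewrite -[leLHS]addr0; apply: lev_wD; exact: pospart_ge0.
rewrite -(ger0_norm t0) -normrZ ger0_norm//.
apply: norm_monotone; first exact: pospart_ge0.
apply: pospart_le; first exact/scalev_wge0/pospart_ge0.
exact/scalev_wle/le_pospart.
Qed.

(* Contractivity is built in so that rank-one operators are bounded; it loses
   nothing, as functionals are only needed up to a positive factor. *)
Definition positive_functional f :=
  (forall x, 0 <= x -> 0 <= f x) /\ (forall x, `|f x| <= `|x|).

(** For [y >= 0] the positive part of [- y] vanishes, so domination gives [f (- y) <= 0];
    contractivity comes from [norm_pospart]. *)
Lemma exists_positive_functional x : ~~ (x <= 0) ->
  exists2 f, positive_functional f & 0 < f x.
Proof.
move=> x0; have [f fp fx] := hahn_banach _ x sublinear_norm_pospart.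
exists f; last by rewrite fx normr_gt0 pospart_eq0.
split=> [y y0|y].
  have := fp (- y); rewrite linearN (_ : pospart (- y) = 0) ?normr0 ?oppr_le0//.
  by apply/eqP; rewrite pospart_eq0 -oppv_ge0 opprK.
rewrite ler_norml lerNl -linearN -{1}normrN.
by rewrite !(le_trans (fp _) (norm_pospart _)).
Qed.

Lemma le_functional x y :
  (forall f, positive_functional f -> f x <= f y) -> x <= y.
Proof.
move=> xy; rewrite -subv_ge0 -opprB oppv_ge0.
apply: contraPT xy => /exists_positive_functional[f f0 fxy] /(_ f f0).
by apply/negP; rewrite -ltNge -subr_gt0 -linearB.
Qed.

Lemma eq_functional x y :
  (forall f, positive_functional f -> f x = f y) -> x = y.
Proof. by move=> xy; apply/le_anti; rewrite !le_functional// => f /xy ->. Qed.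

End BanachLattice.

(** * Multiplication operators on rank-one operators *)

Section RankOne.
Context {R : realType} {X : banachLatticeType R}.
Implicit Types (x y z : X) (f g : {scalar X}) (A B : 'L(X)).

Lemma positive_functional_pos z : 0 <= z -> z != 0 ->
  exists2 f, positive_functional f & 0 < f z.
Proof.
move=> z0 zn0; apply: exists_positive_functional; apply: contra zn0 => z0'.
by apply/eqP/le_anti; rewrite z0 z0'.
Qed.

Lemma bop_neq0 A : A != 0 -> exists2 y, 0 <= y & A y != 0.
Proof.
move=> A0; apply: contrapT => AN0; case/negP: A0; apply/eqP/val_inj/funext => x.
have Apos y : 0 <= y -> A y = 0.
  by move=> y0; apply: contrapT => /eqP Ay; apply: AN0; exists y.
by have [u [v [u0 v0 ->]]] := pos_decomp x; rewrite -[LHS]/(A (u - v)) linearB /= !Apos// subrr.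
Qed.

Lemma bop_pos_eq A B : (forall y, 0 <= y -> A y = B y) -> A =1 B.
Proof.
move=> AB x; have [u [v [u0 v0 ->]]] := pos_decomp x.
by rewrite !linearB /= !AB.
Qed.

Lemma rank1_bounded f y : positive_functional f ->
  (fun x => f x *: y) \in bounded_linear.
Proof.
move=> [_ fb]; apply/bounded_linearP; split=> [a u v|].
  by rewrite linearP scalerDl scalerA.
by exists `|y| => x; rewrite normrZ mulrC ler_wpM2l.
Qed.

Definition rank1 f y (fp : positive_functional f) : 'L(X) :=
  BoundedOp (rank1_bounded f y fp).

Lemma rank1_ge0 f y (fp : positive_functional f) : 0 <= y -> 0 <= rank1 f y fp.
Proof. by move=> y0; apply/bop_leP => x x0; exact/scalev_wge0/y0/fp.1. Qed.

Lemma regular_ge0 A : 0 <= A -> A \in regular.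
Proof.
move=> A0; apply/regularP; exists 1%N, (fun=> 1), (fun=> A).
by rewrite big_ord1 scale1r.
Qed.

(* The band projection property of L_A R_B, tested on T = rank1 f y. *)
Definition rank1_band_projection A B := forall f x y,
  positive_functional f -> 0 <= x -> 0 <= y ->
  [/\ 0 <= f (B x) *: A y, f (B x) *: A y <= f x *: y &
      f (B (B x)) *: A (A y) = f (B x) *: A y].

Lemma mulop_rank1_band_projection A B :
  mulop_band_projection A B -> rank1_band_projection A B.
Proof.
move=> [Phi [PhiE [PhiK Phi01]]] f x y fp x0 y0.
have T0 := rank1_ge0 f y fp y0.
pose T : 'Lr(X) := RegularOp (regular_ge0 _ T0).
have [/bop_leP/(_ x x0) PT0 /bop_leP/(_ x x0) PT1] := Phi01 T T0.
have PTE z : rop_val (Phi T) z = f (B z) *: A y by rewrite PhiE /= linearZ.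
split; [by rewrite -PTE|by rewrite -PTE|].
have := congr1 (fun S : 'Lr(X) => rop_val S x) (PhiK T).
by rewrite /= PTE PhiE /= PTE !linearZ.
Qed.

(** [A] and [B] occur equally often in each term that contains them, so the factors cancel. *)
Lemma rank1_band_projectionZ A B (t : R) : t != 0 ->
  rank1_band_projection A B -> rank1_band_projection (t *: A) (t^-1 *: B).
Proof.
move=> t0 AB f x y fp x0 y0.
have fZ u v : f (t^-1 *: u) *: (t *: v) = f u *: v.
  by rewrite linearZ /= [f _]linearZ /= scalerA mulrA mulfV// mul1r.
have E u v : f ((t^-1 *: B) u) *: (t *: A) v = f (B u) *: A v by exact: fZ.
rewrite !E -[(t^-1 *: B) x]/(t^-1 *: B x) -[(t *: A) y]/(t *: A y).
by rewrite [B (_ *: _)]linearZ [A (_ *: _)]linearZ /= fZ; exact: AB.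
Qed.

Lemma rank1_band_projection_sign A B : A != 0 -> B != 0 ->
  rank1_band_projection A B -> exists2 t : R, t != 0 &
  (0 <= t *: A) /\ (0 <= t^-1 *: B).
Proof.
move=> A0 B0 AB; have [y0 y0_ge0 Ay0] := bop_neq0 A A0.
have [x0 x0_ge0 Bx0] := bop_neq0 B B0.
have [f0 fp0 fx0] : exists2 f, positive_functional f & f (B x0) != 0.
  apply: contrapT => fN; case/eqP: Bx0; apply: eq_functional => f fp.
  by rewrite linear0; apply: contrapT => /eqP fB; apply: fN; exists f.
have tA : 0 <= f0 (B x0) *: A.
  by apply/bop_leP => y y_ge0; have [] := AB f0 x0 y fp0 x0_ge0 y_ge0.
exists (f0 (B x0)) => //; split=> //; apply/bop_leP => x x_ge0.
apply: le_functional => f fp.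
have [+ _ _] := rank1_band_projectionZ _ _ _ fx0 AB f x y0 fp x_ge0 y0_ge0.
set t := f0 (B x0) in fx0 tA *; set b := f _ => h; rewrite leNgt linear0.
apply/negP => b0.
have tAy0 : 0 <= (t *: A) y0 by move/bop_leP: tA; exact.
(* If [b < 0], then [h] gives [(t *: A) y0 <= 0], which together with [tAy0] makes [A y0] vanish. *)
case/eqP: Ay0; apply: (scalerI fx0); rewrite scaler0; apply/le_anti.
rewrite tAy0 andbT -oppv_ge0 -(scalev_le (- b)) ?oppr_gt0//.
by rewrite scaler0 scaleNr scalerN opprK.
Qed.

(** Applying [h] to the upper bound separates the two operators: each quotient [r = f (B x) / f x]
    satisfies [r * h (A y) <= h y]. This bounds the quotients and passes to their supremum. *)
Lemma rank1_band_projection_norm A B : 0 <= A -> A != 0 -> 0 <= B -> B != 0 ->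
  rank1_band_projection A B -> exists2 b : R, 0 < b & forall y, 0 <= y ->
  b *: A y <= y /\ B y <= b *: y.
Proof.
move=> /bop_leP A_ge0 A0 /bop_leP B_ge0 B0 AB.
have [y1 y1_ge0 Ay1] := bop_neq0 A A0; have [x0 x0_ge0 Bx0] := bop_neq0 B B0.
have [g gp gA] := positive_functional_pos _ (A_ge0 _ y1_ge0) Ay1.
have [f0 fp0 fB] := positive_functional_pos _ (B_ge0 _ x0_ge0) Bx0.
have fg f h x y : positive_functional f -> positive_functional h ->
    0 <= x -> 0 <= y -> f (B x) * h (A y) <= f x * h y.
  move=> fp hp x_ge0 y_ge0; have [_ + _] := AB f x y fp x_ge0 y_ge0.
  by rewrite -subv_ge0 => /hp.1; rewrite linearB !scalarZ subr_ge0.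
pose S : set R := [set r | exists f x,
  [/\ positive_functional f, 0 <= x, 0 < f x & r = f (B x) / f x]]%classic.
have Sub r h y : S r -> positive_functional h -> 0 <= y -> r * h (A y) <= h y.
  move=> [f [x [fp x_ge0 fx ->]]] hp y_ge0.
  by rewrite mulrAC ler_pdivrMr// [leRHS]mulrC fg.
(* If [f0 x0 = 0], then [fg] would make the positive product [f0 (B x0) * g (A y1)] at most zero. *)
have fx0 : 0 < f0 x0.
  rewrite lt_neqAle fp0.1// andbT eq_sym.
  apply/eqP => fx0E; have := fg f0 g x0 y1 fp0 gp x0_ge0 y1_ge0.
  by rewrite fx0E mul0r leNgt mulr_gt0.
have S0 : S (f0 (B x0) / f0 x0) by exists f0, x0.
have Sbnd : has_ubound S.
  by exists (g y1 / g (A y1)) => r Sr; rewrite ler_pdivlMr// Sub.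
exists (sup S).
  by apply: lt_le_trans (ub_le_sup Sbnd S0); rewrite divr_gt0.
move=> y y_ge0; split; apply: le_functional => f fp; rewrite linearZ /=.
  have := fp.1 _ (A_ge0 _ y_ge0); rewrite le_eqVlt => /predU1P[<-|fA].
    by rewrite mulr0 fp.1.
  rewrite -ler_pdivlMr//; apply: ge_sup; first by exists (f0 (B x0) / f0 x0).
  by move=> r Sr; rewrite ler_pdivlMr// Sub.
(* When [f y = 0] there is no quotient in [S]; instead [fg], tested with [g (A y1) > 0], gives
   [f (B y) <= 0]. *)
have := fp.1 _ y_ge0; rewrite le_eqVlt => /predU1P[fy|fy].
  rewrite -fy mulr0; have := fg f g y y1 fp gp y_ge0 y1_ge0.
  by rewrite -fy mul0r pmulr_lle0.
by rewrite -ler_pdivrMr//; apply: ub_le_sup => //; exists f, y.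
Qed.

Lemma rank1_band_projection_idem A B : A != 0 -> B != 0 ->
    (forall y, 0 <= y -> 0 <= A y <= y) -> (forall y, 0 <= y -> 0 <= B y <= y) ->
    rank1_band_projection A B ->
  band_projection A /\ band_projection B.
Proof.
move=> A0 B0 A01 B01 AB.
have [y0 y0_ge0 Ay0] := bop_neq0 A A0; have [x0 x0_ge0 Bx0] := bop_neq0 B B0.
have A_ge0 y : 0 <= y -> 0 <= A y by move=> /A01/andP[].
have B_ge0 y : 0 <= y -> 0 <= B y by move=> /B01/andP[].
have [g gp gA] := positive_functional_pos _ (A_ge0 _ y0_ge0) Ay0.
have [f fp fB] := positive_functional_pos _ (B_ge0 _ x0_ge0) Bx0.
have fg h k x y : positive_functional h -> positive_functional k ->
    0 <= x -> 0 <= y -> h (B (B x)) * k (A (A y)) = h (B x) * k (A y).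
  move=> hp kp x_ge0 y_ge0; have [_ _] := AB h x y hp x_ge0 y_ge0.
  by move=> /(congr1 k); rewrite !scalarZ.
have AA h y : positive_functional h -> 0 <= y -> h (A (A y)) <= h (A y).
  move=> hp y_ge0; rewrite -subr_ge0 -linearB hp.1// subv_ge0.
  by have /andP[] := A01 _ (A_ge0 _ y_ge0).
have BB h y : positive_functional h -> 0 <= y -> h (B (B y)) <= h (B y).
  move=> hp y_ge0; rewrite -subr_ge0 -linearB hp.1// subv_ge0.
  by have /andP[] := B01 _ (B_ge0 _ y_ge0).
have fge0 h (C : 'L(X)) y : (forall y, 0 <= y -> 0 <= C y) ->
    positive_functional h -> 0 <= y -> 0 <= h (C (C y)).
  by move=> C_ge0 hp y_ge0; apply: hp.1; exact/C_ge0/C_ge0.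
have AK y : 0 <= y -> A (A y) = A y.
  move=> y_ge0; apply: eq_functional => h hp; apply/le_anti.
  (* [f (B x0) * h (A y) = f (B (B x0)) * h (A (A y)) <= f (B x0) * h (A (A y))], and the positive
     factor [f (B x0)] cancels. *)
  rewrite AA//= -(ler_pM2l fB) -(fg _ _ _ _ fp hp x0_ge0 y_ge0).
  by rewrite ler_wpM2r ?BB// fge0.
have BK y : 0 <= y -> B (B y) = B y.
  move=> y_ge0; apply: eq_functional => h hp; apply/le_anti.
  rewrite BB//= -(ler_pM2r gA) -(fg _ _ _ _ hp gp y_ge0 y0_ge0).
  by rewrite ler_wpM2l ?AA// fge0.
split; split=> [|y].
- exact: (bop_pos_eq (bop_comp A A) A).
- by move/A01/andP.
- exact: (bop_pos_eq (bop_comp B B) B).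
- by move/B01/andP.
Qed.

End RankOne.

(** * Assembling the scalar *)

Lemma mulop_band_projection_scale (R : realType) (X : banachLatticeType R)
    (A B : 'L(X)) : A != 0 -> B != 0 -> mulop_band_projection A B ->
  exists lambda : R, lambda != 0 /\
    band_projection (lambda *: A : 'L(X)) /\
    band_projection (lambda^-1 *: B : 'L(X)).
Proof.
move=> A0 B0 /mulop_rank1_band_projection AB.
have [t t0 [tA tB]] := rank1_band_projection_sign _ _ A0 B0 AB.
have nz (C : 'L(X)) (s : R) : C != 0 -> s != 0 -> s *: C != 0.
  by move=> C0 s0; rewrite scaler_eq0 negb_or s0.
have tV0 : t^-1 != 0 by rewrite invr_eq0.
have [b b0 bAB] := rank1_band_projection_norm _ _ tA (nz _ _ A0 t0) tB
  (nz _ _ B0 tV0) (rank1_band_projectionZ _ _ _ t0 AB).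
have bn0 : b != 0 by rewrite gt_eqF.
have bt0 : b * t != 0 by rewrite mulf_neq0.
have btV0 : (b * t)^-1 != 0 by rewrite invr_eq0.
(* The factor [t] corrects the signs, and [b] then brings both operators below the identity. *)
exists (b * t); split=> //.
apply: rank1_band_projection_idem; [exact: nz|exact: nz| | |].
- move=> y y0; have [+ _] := bAB _ y0; rewrite -scalerA => ->.
  by rewrite andbT; apply: scalev_wge0; [exact: ltW|move/bop_leP: tA; exact].
- have bV0 : 0 < b^-1 by rewrite invr_gt0.
  move=> y y0; rewrite invfM -scalerA; apply/andP; split; last first.
    by rewrite -[leRHS]scale1r -(mulVf bn0) -scalerA scalev_le//; case: (bAB _ y0).
  by apply: scalev_wge0; [exact: ltW|move/bop_leP: tB; exact].
exact: rank1_band_projectionZ.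
Qed.

(** * Multiplication by two band projections *)

Section Converse.
Context {R : realType} {X : banachLatticeType R}.
Implicit Types A B : 'L(X).

Lemma mulopZ A B (t : R) : t != 0 -> mulop (t *: A) (t^-1 *: B) = mulop A B.
Proof.
move=> t0; apply/funext => T; apply/val_inj/funext => x.
rewrite -[LHS]/(t *: A (T (t^-1 *: B x))) [T _]linearZ [A _]linearZ /=.
by rewrite scalerA mulfV// scale1r.
Qed.

Lemma mulop_linear A B : linear (mulop A B).
Proof.
move=> a S T; apply/val_inj/funext => x.
by rewrite -[LHS]/(A (a *: S (B x) + T (B x))) linearP.
Qed.

(** Multiplication by positive operators keeps each summand [P i] positive, and linearity preserves
    the coefficients. *)
Lemma mulop_regular A B (T : 'L(X)) : 0 <= A -> 0 <= B -> T \in regular ->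
  mulop A B T \in regular.
Proof.
move=> /bop_leP A0 /bop_leP B0 /regularP[n [c [P [P0 ->]]]].
pose L := GRing.isLinear.Build R 'L(X) 'L(X) *:%R (mulop A B) (mulop_linear A B).
pose M : {linear 'L(X) -> 'L(X)} := HB.pack (mulop A B) L.
apply/regularP; exists n, c, (fun i => mulop A B (P i)); split=> [i|].
  apply/bop_leP => x x0; have /bop_leP Pi0 := P0 i.
  exact/(A0 (P i (B x)))/Pi0/B0.
rewrite -[LHS]/(M _) linear_sum; apply: eq_bigr => i _; exact: linearZ.
Qed.

Lemma band_projection_mulop A B : band_projection A -> band_projection B ->
  mulop_band_projection A B.
Proof.
move=> [AK A01] [BK B01].
have A0 : 0 <= A by apply/bop_leP => x /A01[].
have B0 : 0 <= B by apply/bop_leP => x /B01[].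
pose F (T : 'Lr(X)) : 'Lr(X) := RegularOp (mulop_regular A B T A0 B0 (valP T)).
have Flin : linear F by move=> a S T; apply/val_inj; exact: mulop_linear.
pose L := GRing.isLinear.Build R 'Lr(X) 'Lr(X) *:%R F Flin.
pose Phi : {linear 'Lr(X) -> 'Lr(X)} := HB.pack F L.
exists Phi; split=> //; split=> [T|T /bop_leP T0].
  by apply/val_inj/val_inj/funext => x /=; rewrite AK BK.
have TB0 x : 0 <= x -> 0 <= T (B x) by move=> /B01[/T0].
split; apply/bop_leP => x x0; first exact: (A01 _ (TB0 _ x0)).1.
(* The chain is [A (T (B x)) <= T (B x) <= T x], the second step by positivity of [T] on
   [x - B x]. *)
apply: le_trans (A01 _ (TB0 _ x0)).2 _.
by rewrite -subv_ge0 -linearB; apply: T0; rewrite subv_ge0; exact: (B01 _ x0).2.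
Qed.

End Converse.

Theorem theorem4p5 (R : realType) (X : banachLatticeType R)
  (dcX : dedekind_complete X) (A B : 'L(X)) (A0 : A != 0) (B0 : B != 0) :
  mulop_band_projection A B <->
  exists lambda : R, lambda != 0 /\
    band_projection (lambda *: A : 'L(X)) /\
    band_projection (lambda^-1 *: B : 'L(X)).
Proof.
split; first exact: mulop_band_projection_scale.
move=> [lambda [l0 [lA lB]]].
have [Phi [PhiE PhiP]] := band_projection_mulop _ _ lA lB.
by exists Phi; split=> // T; rewrite PhiE mulopZ.
Qed.
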